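(* Let $p_n$ be the number of pop-stacked permutations of size $n$. Then $p_n\ge \exp\big(n\ln n-n\ln 2-n+o(n)\big)$ as $n\to\infty$.
   Context: Falls of a permutation are its maximal decreasing strings of consecutive entries. The flip $T$ reverses every fall in place; a permutation is pop-stacked if it lies in the image of $T$. *)

(* Defs.v *)
From mathcomp Require Import all_boot all_order all_fingroup all_algebra.
From mathcomp Require Import all_classical all_reals all_analysis.

Set Implicit Arguments.
Unset Strict Implicit.
Unset Printing Implicit Defensive.

Fixpoint falls (s : seq nat) : seq (seq nat) :=
  if s is x :: s' then
    if falls s' is (y :: f) :: fs then
      if y < x then (x :: y :: f) :: fs else [:: x] :: (y :: f) :: fs
    else [:: [:: x]]
  else [::].

Definition flip (s : seq nat) : seq nat := flatten (map rev (falls s)).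

(* One-line notation, with values 0, ..., n - 1 instead of 1, ..., n. *)
Definition oneline (n : nat) (s : 'S_n) : seq nat :=
  [seq val (s i) | i <- enum 'I_n].

Definition pop_stacked (n : nat) (s : 'S_n) : bool :=
  [exists t : 'S_n, oneline s == flip (oneline t)].

Definition num_pop_stacked (n : nat) : nat := #|[set s : 'S_n | pop_stacked s]|.

(* [falls s] cuts s into nonempty decreasing blocks of consecutive entries; *)
(* the last lemma is maximality: no block ends above the head of the next. *)
Lemma falls_nonnil s : all (fun f => f != [::]) (falls s).
Proof.
elim: s => //= x s; case: (falls s) => [|[|y f] fs] //= H.
by case: ifP.
Qed.

Lemma flatten_falls s : flatten (falls s) = s.
Proof.
elim: s => //= x s IH; have := falls_nonnil s; move: IH.
case: (falls s) => [|[|y f] fs] //= <- //.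
by case: ifP.
Qed.

Lemma falls_decreasing s : all (sorted gtn) (falls s).
Proof.
elim: s => //= x s; case: (falls s) => [|[|y f] fs] //= /andP[pf sfs].
by case: ifP => /= [yx|_]; rewrite ?pf ?sfs ?andbT.
Qed.

Lemma falls_maximal s :
  sorted (fun f g : seq nat => last 0 f <= head 0 g) (falls s).
Proof.
elim: s => //= x s; case: (falls s) => [|[|y f] fs] //= pf.
by case: ltnP => /= [_|xy]; rewrite ?xy //; case: fs pf.
Qed.

Lemma perm_flip s : perm_eq (flip s) s.
Proof.
rewrite -{2}(flatten_falls s) /flip.
elim: (falls s) => //= f fs IH.
by apply: perm_cat => //; rewrite perm_rev.
Qed.

(* Main.v *)
Require Import Defs.
From mathcomp Require Import all_boot all_order all_fingroup all_algebra.
From mathcomp Require Import all_classical all_reals all_analysis.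
From mathcomp Require Import ring lra zify.
Import Order.TTheory GRing.Theory Num.Theory.
Import numFieldNormedType.Exports.
Local Open Scope classical_set_scope.
Local Open Scope ring_scope.

(** Put m = n./2. Interleaving an arrangement l of the m smallest values with an
    arrangement h of the next m values (and, for odd n, appending the largest
    value) gives l_1 h_1 l_2 h_2 ..., which is the flip of h_1 l_1 h_2 l_2 ...:
    every fall of the latter is a pair h_i l_i, because l_i < h_(i+1). Hence
    p_n >= (m!)^2, and m! >= (m / e)^m yields the bound with an error term
    -2 sqrt n, which absorbs the ln n lost by rounding when n is odd. *)

Definition interleave (s t : seq nat) : seq nat :=
  flatten [seq [:: p.1; p.2] | p <- zip s t].

Lemma perm_interleave s t :
  size s = size t -> perm_eq (interleave s t) (s ++ t).
Proof.
elim: s t => [|x s IH] [|y t] //= [/IH st].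
rewrite /interleave /= perm_cons perm_sym -cat1s perm_catCA /= perm_cons.
by rewrite perm_sym.
Qed.

Lemma interleave_inj s t s' t' :
  size s = size t -> size s' = size t' ->
  interleave s t = interleave s' t' -> s = s' /\ t = t'.
Proof.
elim: s t s' t' => [|x s IH] [|y t] [|x' s'] [|y' t'] //= [st] [st'].
by rewrite /interleave /= => -[-> -> /(IH _ _ _ st st') [-> ->]].
Qed.

(** The bound on [head l u] ends the first fall right after [l], so this fall is the pair [h], [l];
    the default [l] makes the condition vacuous when [u] is empty. *)
Lemma flip_descent h l u :
  (l < h)%N -> (l <= head l u)%N -> flip [:: h, l & u] = [:: l, h & flip u].
Proof.
move=> lh; rewrite /flip /=; case: u => [|y u] lu; first by rewrite /= lh.
have := falls_nonnil (y :: u); have := flatten_falls (y :: u).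
case: (falls (y :: u)) => [|[|z f] fs] //= [-> _] _.
by rewrite ltnNge lu /= lh.
Qed.

Lemma flip_interleave m s t u :
  size s = size t -> all (ltn^~ m) s -> all (leq m) t -> (m <= head m u)%N ->
  flip (interleave t s ++ u) = interleave s t ++ flip u.
Proof.
elim: s t => [|x s IH] [|y t] //= [st] /andP[xm sm] /andP[my mt] mu.
rewrite /interleave /= -!/(interleave _ _) flip_descent ?IH //.
  exact: leq_trans my.
(* The entry after [y], [x], if any, is the head of the remaining [t], or that of [u] once the lists
   are exhausted; either is at least [m], hence above [x]. *)
case: t s st mt {IH sm} => [|z t] [|w s] //= _.
  by case: u mu => //= z u mz _; exact/ltnW/(leq_trans xm).
by case/andP=> mz _; exact/ltnW/(leq_trans xm).
Qed.

Lemma perm_oneline n (s : 'S_n) : perm_eq (oneline s) (iota 0 n).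
Proof.
rewrite -val_enum_ord /oneline (map_comp val s) perm_map //.
apply: uniq_perm; rewrite ?enum_uniq //.
  by rewrite (map_inj_uniq (@perm_inj _ s)) enum_uniq.
move=> i; rewrite mem_enum; apply/mapP; exists (s^-1 i)%g; rewrite ?mem_enum //.
by rewrite permKV.
Qed.

Lemma oneline_inj n : injective (@oneline n).
Proof.
move=> s t /eq_in_map st; apply/permP => i; apply/val_inj/st.
by rewrite mem_enum.
Qed.

Lemma size_oneline n (s : 'S_n) : size (oneline s) = n.
Proof. by rewrite size_map size_enum_ord. Qed.

Lemma perm_iota_oneline n (w : seq nat) :
  perm_eq w (iota 0 n) -> exists s : 'S_n, oneline s = w.
Proof.
move=> wn; have sw : size w = n by rewrite (perm_size wn) size_iota.
have uw : uniq w by rewrite (perm_uniq wn) iota_uniq.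
have wlt (i : 'I_n) : (nth 0%N w i < n)%N.
  have : nth 0%N w i \in w by rewrite mem_nth ?sw.
  by rewrite (perm_mem wn) mem_iota.
have f_inj : injective (fun i => Ordinal (wlt i)).
  move=> i j [/eqP]; rewrite nth_uniq ?sw // => /eqP ij; exact: val_inj.
exists (perm f_inj); apply: (@eq_from_nth _ 0%N); rewrite size_oneline ?sw //.
move=> i ilt; rewrite (nth_map (Ordinal ilt)) ?size_enum_ord // permE /=.
by rewrite nth_enum_ord.
Qed.

Lemma leq_fact_half_num_pop_stacked n :
  ((n./2)`! ^ 2 <= num_pop_stacked n)%N.
Proof.
(* For odd n, [u] holds the one value n - 1 = 2m left over by the two halves; for even n it is
   empty. *)
set m := n./2; set u := nseq (odd n) (m + m)%N.
pose hi (b : 'S_m) := map (addn m) (oneline b).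
have size_hi (a b : 'S_m) : size (oneline a) = size (hi b).
  by rewrite size_oneline size_map size_oneline.
have perm_all (a b : 'S_m) : perm_eq ((oneline a ++ hi b) ++ u) (iota 0 n).
  have -> : iota 0 n = (iota 0 m ++ map (addn m) (iota 0 m)) ++ u.
    rewrite -iotaDl addn0 -iotaD /u -[in LHS](odd_double_half n) -/m.
    rewrite addnC iotaD -addnn add0n.
    by case: (odd n).
  rewrite perm_cat2r; apply: perm_cat; first exact: perm_oneline.
  exact/perm_map/perm_oneline.
(* Choosing such an [s] for each pair gives a map from pairs to permutations of size n; its
   injectivity yields the count (m!)^2. *)
have word (ab : 'S_m * 'S_m) : exists s : 'S_n,
    oneline s = interleave (oneline ab.1) (hi ab.2) ++ u.
  apply: perm_iota_oneline; apply: perm_trans (perm_all ab.1 ab.2).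
  by rewrite perm_cat2r perm_interleave.
have [f fE] := boolp.choice word.
have f_inj : injective f.
  move=> [a b] [a' b'] /(congr1 (@oneline n)); rewrite !fE /= => /eqP.
  rewrite eqseq_cat; last first.
    by rewrite !(perm_size (perm_interleave _ _ _)) // !size_cat !size_map.
  rewrite eqxx andbT => /eqP /interleave_inj[] // /oneline_inj -> hE.
  by congr (_, _); apply/oneline_inj/(inj_map (@addnI m)).
rewrite -card_Sn -mulnn -card_prod -(card_imset _ f_inj) subset_leq_card //.
apply/fintype.subsetP => _ /imsetP[[a b] _ ->]; rewrite inE; apply/existsP.
(* The preimage under [flip] interleaves the same two lists with their roles exchanged. *)
have [|t tE] := @perm_iota_oneline n (interleave (hi b) (oneline a) ++ u).
  apply: perm_trans (perm_all a b); rewrite perm_cat2r.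
  by rewrite (perm_trans (perm_interleave _ _ _)) // perm_catC.
exists t; rewrite fE tE (@flip_interleave m) //.
- by rewrite /u; case: (odd n).
- by apply/allP => x; rewrite (perm_mem (perm_oneline _ a)) mem_iota.
- by apply/allP => x /mapP[y _ ->]; rewrite leq_addr.
- by rewrite /u; case: (odd n) => //=; rewrite leq_addr.
Qed.

(** The single term m^m / m! of the exponential series at m is at most e^m. *)
Lemma expR_xlnx_le_fact (R : realType) m :
  expR (m%:R * ln m%:R - m%:R) <= (m`!)%:R :> R.
Proof.
case: m => [|m]; first by rewrite mul0r subr0 expR0.
rewrite expRD expRN expRM_natl lnK ?posrE ?ltr0n //.
rewrite ler_pdivrMr ?expR_gt0 // -ler_pdivrMl ?ltr0n ?fact_gt0 // mulrC.
by apply: le_trans (expR_ge1Dxn m (ler0n R m.+1)); rewrite lerDr.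
Qed.

(** Since ln x = 2 ln(sqrt x), it suffices that ln y < y at y = sqrt x. *)
Lemma ln_le_2sqrt (R : realType) (x : R) : 0 < x -> ln x <= 2 * Num.sqrt x.
Proof.
move=> x0; have s0 : 0 < Num.sqrt x by rewrite sqrtr_gt0.
rewrite -[in ln x](sqr_sqrtr (ltW x0)) lnXn // -(mulr_natl (ln _)).
by rewrite ler_pM2l // ltW // ln_sublinear.
Qed.

Lemma sqrt_littleo (R : realType) :
  (fun n : nat => - (2 * Num.sqrt n%:R) : R) =o_\oo (fun n : nat => n%:R : R).
Proof.
apply/eqoP => eps eps0.
near=> n; rewrite normrN normr_nat ger0_norm ?mulr_ge0 ?sqrtr_ge0 //.
rewrite -[in leRHS](sqr_sqrtr (ler0n R n)) expr2 mulrA.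
rewrite ler_wpM2r ?sqrtr_ge0 // -ler_pdivrMl // mulrC.
(* What remains is 2 / eps <= sqrt n, which holds once n >= (2 / eps)^2. *)
have c0 : 0 <= 2 / eps by rewrite divr_ge0 // ltW.
rewrite -(ger0_norm c0) -sqrtr_sqr ler_sqrt ?ler0n //.
by near: n; exact: nbhs_infty_ger.
Unshelve. all: by end_near. Qed.

(** For n = 2m the two sides differ only by the square root term. For n = 2m + 1, n ln n is at most
    2m ln(2m) + 1 + ln n; the 1 is offset by -n against -2m, and ln n by 2 sqrt n. *)
Lemma xlnx_half_bound (R : realType) n : (1 < n)%N ->
  n%:R * ln n%:R - n%:R * ln 2 - n%:R - 2 * Num.sqrt n%:R <=
  ((n./2)%:R * ln (n./2)%:R - (n./2)%:R) * 2 :> R.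
Proof.
move=> n1; set m := n./2.
have m0 : (0 < m)%N by rewrite /m; lia.
have mR : 0 < m%:R :> R by rewrite ltr0n.
have nR : 0 < n%:R :> R by rewrite ltr0n; lia.
have ln2 : 0 <= ln 2 :> R by rewrite ln_ge0 // ler1n.
have lnn := @ln_le_2sqrt R _ nR.
have ln2m : ln (2 * m%:R) = ln 2 + ln m%:R :> R by rewrite lnM ?posrE.
have [b_odd|b_even] := boolP (odd n); last first.
  have nE : n%:R = 2 * m%:R :> R by rewrite -natrM; congr _%:R; rewrite /m; lia.
  have sqrt0 := sqrtr_ge0 (n%:R : R).
  by move: sqrt0; rewrite nE ln2m; move: (Num.sqrt _) => q; nra.
have nE : n%:R = 2 * m%:R + 1 :> R.
  by rewrite -natrM natr1; congr _%:R; rewrite /m; lia.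
have m2 : 0 < 2 * m%:R :> R by rewrite mulr_gt0.
(* This is ln(1 + x) <= x at x = 1 / (2m). *)
have ratio : 2 * m%:R * (ln n%:R - ln (2 * m%:R)) <= 1 :> R.
  rewrite -ler_pdivlMl // mulr1 -ln_div ?posrE //.
  have -> : n%:R / (2 * m%:R) = 1 + (2 * m%:R)^-1 :> R.
    by rewrite nE mulrDl mul1r divff // gt_eqF.
  by apply: le_ln1Dx; rewrite (lt_trans (ltrN10 R)) // invr_gt0.
move: ratio lnn; rewrite ln2m; move: (Num.sqrt _) (ln n%:R) => q L.
rewrite nE; nra.
Qed.

Theorem theorem12 (R : realType) :
  exists2 e : nat -> R,
    e =o_\oo (fun n : nat => n%:R : R) &
    \forall n \near \oo,
      expR (n%:R * ln n%:R - n%:R * ln 2 - n%:R + e n)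
        <= (num_pop_stacked n)%:R :> R.
Proof.
exists (fun n : nat => - (2 * Num.sqrt n%:R)); first exact: sqrt_littleo.
near=> n; have n1 : (1 < n)%N by near: n; exact: nbhs_infty_gt.
apply: le_trans (_ : ((n./2)`!)%:R ^+ 2 <= _); last first.
  by rewrite -natrX ler_nat leq_fact_half_num_pop_stacked.
apply: le_trans (_ : expR (((n./2)%:R * ln (n./2)%:R - (n./2)%:R) * 2) <= _).
  by rewrite ler_expR xlnx_half_bound.
by rewrite mulrC expRM_natl lerXn2r ?nnegrE ?expR_ge0 ?expR_xlnx_le_fact.
Unshelve. all: by end_near. Qed.
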